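(* Let $\{P_\theta:\theta\in\mathbb{R}^d\}$ be a statistical model on $(\mathcal{X},\mathcal{A})$, $\psi:\mathbb{R}^d\to\mathbb{R}^k$ a measurable functional, and $\|\cdot\|$ any norm on $\mathbb{R}^k$. For any probability measure $Q$ on $\mathbb{R}^d$ and $h\in\mathbb{R}^d$ define $$A_{\psi,Q,h}:=\frac{\left\|\int_{\mathbb{R}^d}(\psi(t)-\psi(t-h))\,dQ(t)\right\|^2}{4H^2(\mathbb{P}_0,\mathbb{P}_h)},\qquad B_{\psi,Q,h}:=\int_{\mathbb{R}^d}\|\psi(t)-\psi(t-h)\|^2\,dQ(t).$$ Then for any probability measure $Q$ on $\mathbb{R}^d$, $$\inf_T\sup_{\theta\in\mathbb{R}^d}\mathbb{E}_\theta\|T(X)-\psi(\theta)\|^2\ \ge\ \sup_{h\in\mathbb{R}^d}\left[\sqrt{A_{\psi,Q,h}}-\sqrt{B_{\psi,Q,h}}\right]_+^2,$$ where the infimum is over measurable $T:\mathcal{X}\to\mathbb{R}^k$.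
   Context: All $P_\theta$ have densities with respect to a common $\sigma$-finite measure, measurable jointly in $(x,\theta)$. $\mathbb{E}_\theta$ is expectation under $X\sim P_\theta$; $[x]_+=\max(x,0)$. The probability measures $\mathbb{P}_0,\mathbb{P}_h$ on $\mathcal{X}\times\mathbb{R}^d$ (depending on $Q$) are $d\mathbb{P}_0(x,\theta)=dP_\theta(x)\,dQ(\theta)$ and $d\mathbb{P}_h(x,\theta)=dP_{\theta+h}(x)\,dQ(\theta+h)$; i.e. $\mathbb{P}_h$ is the law of $(X,\vartheta-h)$ when $\vartheta\sim Q$ and $X\mid\vartheta\sim P_\vartheta$. The Hellinger distance is $H^2(P_0,P_1)=\int(dP_0^{1/2}-dP_1^{1/2})^2$ (densities with respect to a common dominating measure). Conventions: $0/0=0$, and the bracket is $0$ if $B_{\psi,Q,h}=\infty$. *)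

(* Defs.v *)
From HB Require Import structures.
From mathcomp Require Import all_boot all_order all_algebra.
From mathcomp Require Import all_classical all_reals all_analysis.
From mathcomp Require Import measurable_realfun.

Set Implicit Arguments.
Unset Strict Implicit.
Unset Printing Implicit Defensive.

Import Order.TTheory GRing.Theory Num.Theory.
Import numFieldNormedType.Exports.

Local Open Scope classical_set_scope.
Local Open Scope ring_scope.
Local Open Scope ereal_scope.

(* R^n carries its Borel sigma-algebra, generated by the open sets of the
   library's (sup-norm) topology on row vectors. *)
HB.instance Definition _ (R : realType) (n : nat) :=
  isMeasurable.Build (sigma_display (@open 'rV[R]_n)) 'rV[R]_n
    (@sigma_algebra0 _ setT (@open 'rV[R]_n))
    (@sigma_algebraC _ (@open 'rV[R]_n))
    (@sigma_algebra_bigcup _ setT (@open 'rV[R]_n)).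

Lemma continuous_measurable_rV (R : realType) (m n : nat)
    (f : 'rV[R]_m -> 'rV[R]_n) :
  continuous f -> measurable_fun [set: 'rV[R]_m] f.
Proof.
move=> cf; apply: (@measurability _ _ _ _ setT f (@open 'rV[R]_n)) => //.
move=> _ [B oB <-]; rewrite setTI; apply: sub_sigma_algebra.
by move/continuousP : cf; exact.
Qed.

Record is_norm (R : realType) (k : nat) (N : 'rV[R]_k -> R) : Prop := IsNorm {
  is_normD : forall u v, (N (u + v) <= N u + N v)%R ;
  is_normZ : forall a u, N (a *: u)%R = (`|a| * N u)%R ;
  is_norm0_eq0 : forall u, N u = 0%R -> u = 0%R }.

(* A family of probability measures having densities with respect to a common
   sigma-finite measure, jointly measurable in the observation and the
   parameter. *)
Record dominated_model (dX dT : measure_display) (X : measurableType dX)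
    (Theta : measurableType dT) (R : realType) := DominatedModel {
  law :> Theta -> probability X R ;
  dominating : {sigma_finite_measure set X -> \bar R} ;
  density : X * Theta -> R ;
  density_ge0 : forall z, (0 <= density z)%R ;
  measurable_density : measurable_fun [set: X * Theta] density ;
  law_density : forall theta A, measurable A ->
    law theta A = \int[dominating]_(x in A) (density (x, theta))%:E }.

Section joint_law.
Context (dX dT : measure_display) (X : measurableType dX)
  (Theta : measurableType dT) (R : realType).
Variables (P : dominated_model X Theta R) (Q : probability Theta R).

Lemma measurable_law_ysection (C : set (X * Theta)) : measurable C ->
  measurable_fun [set: Theta] (fun theta => P theta (ysection C theta)).
Proof.
move=> mC; rewrite (_ : (fun _ => _) = fubini_G (dominating P)
    (fun z => (density P z * \1_C z)%:E)); last first.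
  apply/funext => theta; rewrite law_density; last exact: measurable_ysection.
  rewrite integral_mkcond; apply: eq_integral => x _.
  rewrite patchE indicE mem_ysection.
  by case: ifP => _ /=; rewrite ?mulr1 ?mulr0.
apply: measurable_fun_fubini_tonelli_G.
  apply/measurable_EFinP/measurable_funM; first exact: measurable_density.
  exact: measurable_indic.
by move=> z; rewrite lee_fin mulr_ge0 ?density_ge0.
Qed.

(* The law of (X, theta) when theta ~ Q and X | theta ~ P_theta, that is
   dP_theta(x) dQ(theta). *)
Definition joint_law (C : set (X * Theta)) : \bar R :=
  \int[Q]_theta P theta (ysection C theta).

Lemma joint_law0 : joint_law set0 = 0.
Proof. by apply: integral0_eq => theta _; rewrite ysection0 measure0. Qed.

Lemma joint_law_ge0 C : 0 <= joint_law C.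
Proof. by apply: integral_ge0 => *; exact: measure_ge0. Qed.

Lemma joint_law_sigma_additive : semi_sigma_additive joint_law.
Proof.
move=> F mF tF mUF.
rewrite [X in _ --> X](_ : _ = \sum_(n <oo) joint_law (F n)).
  apply/cvg_closeP; split; last by rewrite closeE.
  by apply: is_cvg_nneseries => *; exact: joint_law_ge0.
rewrite /joint_law -integral_nneseries//; last first.
  by move=> n; exact: measurable_law_ysection.
apply: eq_integral => theta _; apply/esym/cvg_lim => //=.
rewrite ysection_bigcup.
apply: (measure_sigma_additive _ (trivIset_ysection tF)) => n.
exact: measurable_ysection.
Qed.

HB.instance Definition _ := isMeasure.Build _ _ _ joint_law
  joint_law0 joint_law_ge0 joint_law_sigma_additive.

Lemma joint_law_setT : joint_law setT = 1.
Proof.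
rewrite /joint_law (eq_integral (cst 1)).
  by rewrite integral_cst// mul1e; exact: probability_setT.
move=> theta _; rewrite [ysection _ _](_ : _ = setT) ?probability_setT//.
by apply/seteqP; split => // x _; rewrite /ysection/= inE.
Qed.

HB.instance Definition _ :=
  Measure_isProbability.Build _ _ _ joint_law joint_law_setT.

End joint_law.

Section shifted_law.
Context (dX : measure_display) (X : measurableType dX) (R : realType) (d : nat).

Definition shift_parameter (h : 'rV[R]_d) (z : X * 'rV[R]_d) : X * 'rV[R]_d :=
  (z.1, (z.2 - h)%R).

Lemma measurable_shift_parameter h :
  measurable_fun [set: X * 'rV[R]_d] (shift_parameter h).
Proof.
apply/measurable_fun_pairP; split => /=; first exact: measurable_fst.
apply: (measurableT_comp (f := fun t : 'rV[R]_d => (t - h)%R)).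
  apply: continuous_measurable_rV => t.
  by apply: (@continuousB _ _ _ id (cst h) t); [exact: id|exact: cst_continuous].
exact: measurable_snd.
Qed.

HB.instance Definition _ (h : 'rV[R]_d) :=
  isMeasurableFun.Build _ _ _ _ (shift_parameter h) (measurable_shift_parameter h).

(* The law of (X, theta - h) when theta ~ Q and X | theta ~ P_theta, that is
   dP_(theta + h)(x) dQ(theta + h). *)
Definition shifted_joint_law (P : dominated_model X 'rV[R]_d R)
    (Q : probability 'rV[R]_d R) (h : 'rV[R]_d) : probability (X * 'rV[R]_d)%type R :=
  distribution (joint_law P Q) (shift_parameter h).

End shifted_law.

Section hellinger.
Context (dT : measure_display) (T : measurableType dT) (R : realType).
Variables P0 P1 : probability T R.

Lemma measure_add_fin_num : fin_num_fun (measure_add P0 P1).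
Proof. by move=> A mA; rewrite measure_addE fin_numD !fin_num_measure. Qed.

HB.instance Definition _ := Measure.on (measure_add P0 P1).
HB.instance Definition _ :=
  Measure_isFinite.Build _ _ _ (measure_add P0 P1) measure_add_fin_num.

(* Squared Hellinger distance. Its value does not depend on the common
   dominating measure; P0 + P1 is used. *)
Definition hellinger2 : \bar R :=
  let f0 := Radon_Nikodym (charge_of_finite_measure P0) (measure_add P0 P1) in
  let f1 := Radon_Nikodym (charge_of_finite_measure P1) (measure_add P0 P1) in
  \int[measure_add P0 P1]_z (sqrte (f0 z) - sqrte (f1 z)) ^+ 2.

End hellinger.

Section bound.
Context (dX : measure_display) (X : measurableType dX) (R : realType) (d k : nat).
Variables (P : dominated_model X 'rV[R]_d R) (psi : 'rV[R]_d -> 'rV[R]_k)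
  (N : 'rV[R]_k -> R).

Definition risk (T : X -> 'rV[R]_k) (theta : 'rV[R]_d) : \bar R :=
  \int[P theta]_x ((N (T x - psi theta)) ^+ 2)%:E.

Definition minimax_risk : \bar R :=
  ereal_inf [set ereal_sup [set risk T theta | theta in [set: 'rV[R]_d]] |
    T in [set T : X -> 'rV[R]_k | measurable_fun [set: X] T]].

Variables (Q : probability 'rV[R]_d R) (h : 'rV[R]_d).

Definition mean_increment : 'rV[R]_k :=
  \row_j (\int[Q]_t (psi t 0 j - psi (t - h) 0 j))%R.

(* Division in \bar R is such that 0 / 0 = 0. *)
Definition A_psi : \bar R :=
  ((N mean_increment) ^+ 2)%:E /
  (4%:E * hellinger2 (joint_law P Q) (shifted_joint_law P Q h)).

Definition B_psi : \bar R :=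
  \int[Q]_t ((N (psi t - psi (t - h))) ^+ 2)%:E.

(* If B_psi is finite, the coordinates of the increment are Q-integrable, so
   that A_psi is meaningful; otherwise the bracket is 0 by convention. *)
Definition bracket : \bar R :=
  if B_psi == +oo then 0 else Order.max (sqrte A_psi - sqrte B_psi) 0.

End bound.

(* Main.v *)
Require Import Defs.
From HB Require Import structures.
From mathcomp Require Import all_boot all_order all_algebra.
From mathcomp Require Import all_classical all_reals all_analysis.
From mathcomp Require Import measurable_realfun.
From mathcomp Require Import ring lra.

Set Implicit Arguments.
Unset Strict Implicit.
Unset Printing Implicit Defensive.

Import Order.TTheory GRing.Theory Num.Theory.
Import numFieldNormedType.Exports.

Local Open Scope classical_set_scope.
Local Open Scope ring_scope.
Local Open Scope ereal_scope.
Local Open Scope charge_scope.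

(** Fix an estimator T whose risk is at most M everywhere, a prior Q and a
shift h.  Let u(x, t) = T(x) - psi(t) be the error of T, and let P_0 and P_h be
the laws of (X, theta) and (X, theta - h).  Passing from P_0 to P_h replaces
psi(theta) by psi(theta - h) and leaves X alone, so
  E_h u - E_0 u = int (psi(t) - psi(t - h)) dQ(t) =: D.
The error thus has to detect the difference between P_0 and P_h, and it can do
so only as far as these laws are separated in Hellinger distance.

To make this quantitative, compose u with a linear functional l that attains
the norm at D and is dominated by the norm ([norm_support]); then g = l(u) is
real, |g| <= ||u|| and E_h g - E_0 g = ||D||.  Writing p_0 and p_h for the
densities, g (p_0 - p_h) = g (sqrt p_0 - sqrt p_h) (sqrt p_0 + sqrt p_h) and
Young's inequality give, for every eta > 0,
  ||D|| <= eta H^2 + (E_0 g^2 + E_h g^2) / (2 eta)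
([hellinger_mean_difference]).  Now E_0 g^2 <= M, because the Bayes risk is at
most the maximal risk, and E_h g^2 <= (sqrt M + sqrt B)^2 by Minkowski's
inequality, because under P_h the error is u plus the increment of psi.
Optimising over eta, ||D|| <= 2 H (sqrt M + sqrt B), that is
sqrt A <= sqrt M + sqrt B, which is the theorem.

The integral estimates avoid square roots of integrals: M and B are replaced by
upper bounds a^2 and b^2 with a, b > 0, Minkowski's inequality by the pointwise
convexity inequality [sqr_add_le], and a, b are optimised at the very end. *)

(** * Supporting functionals of sublinear functions *)

Section sublinear.
Context (R : realType) (k : nat).
Local Open Scope ring_scope.

Record is_sublinear (p : 'rV[R]_k -> R) : Prop := IsSublinear {
  sublinearD : forall u v, p (u + v) <= p u + p v ;
  sublinearZ : forall a u, 0 <= a -> p (a *: u) = a * p u }.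

Lemma sublinear0 p : is_sublinear p -> p 0 = 0.
Proof. by move=> [_ pZ]; rewrite -(scale0r 0) pZ ?mul0r. Qed.

Lemma sublinear_geN p u : is_sublinear p -> - p (- u) <= p u.
Proof.
move=> sp; have := sublinearD sp u (- u).
by rewrite subrr (sublinear0 sp); lra.
Qed.

(** The one-sided directional derivative of [p] at [w] along [u]: since [p] is
positively homogeneous, the quotient (p(w + e u) - p(w)) / e is the expression
below at t = 1 / e, and by convexity its limit as e decreases to 0 is an
infimum.  The value t = 0 adds p(u), which is the limit at e = +oo. *)
Definition directional_derivative (p : 'rV[R]_k -> R) (w u : 'rV[R]_k) : R :=
  inf [set p (u + t *: w) - t * p w | t in [set t | 0 <= t]].

Section directional_derivative_theory.
Variables (p : 'rV[R]_k -> R) (w : 'rV[R]_k).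
Hypothesis sp : is_sublinear p.

Let range u := [set p (u + t *: w) - t * p w | t in [set t | 0 <= t]].

Let range_lb u : lbound (range u) (- p (- u)).
Proof.
move=> _ [t /= t0 <-]; rewrite -(sublinearZ sp _ t0).
have := sublinearD sp (u + t *: w) (- u).
by rewrite addrAC subrr add0r; lra.
Qed.

Let has_inf_range u : has_inf (range u).
Proof.
split; last by exists (- p (- u)); exact: range_lb.
by exists (p (u + 0 *: w) - 0 * p w), 0 => //=.
Qed.

Lemma directional_derivative_le t u : 0 <= t ->
  directional_derivative p w u <= p (u + t *: w) - t * p w.
Proof.
by move=> t0; apply: ge_inf; [exact: (has_inf_range u).2|exists t].
Qed.

Lemma directional_derivative_ge c u :
  (forall t, 0 <= t -> c <= p (u + t *: w) - t * p w) ->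
  c <= directional_derivative p w u.
Proof.
move=> cp; apply: lb_le_inf; first exact: (has_inf_range u).1.
by move=> _ [t /= t0 <-]; exact: cp.
Qed.

Lemma directional_derivative_le_id u : directional_derivative p w u <= p u.
Proof.
by have := @directional_derivative_le 0 u (lexx _); rewrite scale0r addr0 mul0r subr0.
Qed.

Lemma directional_derivativeN : directional_derivative p w (- w) <= - p w.
Proof.
have := @directional_derivative_le 1 (- w) ler01.
by rewrite scale1r addNr (sublinear0 sp) mul1r sub0r.
Qed.

Lemma directional_derivative_sublinear : is_sublinear (directional_derivative p w).
Proof.
split=> [u v|a u].
  rewrite -lerBlDr; apply: directional_derivative_ge => t t0.
  rewrite lerBlDr -lerBlDl; apply: directional_derivative_ge => s s0; rewrite lerBlDl.
  apply: le_trans (directional_derivative_le _ (addr_ge0 t0 s0)) _.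
  have := sublinearD sp (u + t *: w) (v + s *: w).
  by rewrite addrACA -scalerDl; lra.
rewrite le_eqVlt => /predU1P[<-|a0].
  rewrite mul0r scale0r; apply/le_anti/andP; split.
    by rewrite -[leRHS](sublinear0 sp) directional_derivative_le_id.
  apply: directional_derivative_ge => t t0; rewrite add0r (sublinearZ sp)//; lra.
apply/le_anti/andP; split.
  rewrite -ler_pdivrMl//; apply: directional_derivative_ge => t t0.
  rewrite ler_pdivrMl//.
  apply: le_trans (directional_derivative_le _ (mulr_ge0 (ltW a0) t0)) _.
  by rewrite -scalerA -scalerDr (sublinearZ sp _ (ltW a0)); lra.
apply: directional_derivative_ge => t t0.
have t'0 : 0 <= a^-1 * t by rewrite mulr_ge0 ?invr_ge0 ?(ltW a0).
rewrite -ler_pdivlMl//; apply: le_trans (directional_derivative_le _ t'0) _.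
rewrite mulrBr mulrA -(sublinearZ sp (a *: u + t *: w)) ?invr_ge0 ?(ltW a0)//.
by rewrite scalerDr !scalerA mulVf ?gt_eqF// scale1r.
Qed.

End directional_derivative_theory.

(** Finite-dimensional Hahn-Banach.  Differentiating [p] at [w] gives a smaller
sublinear function, odd at [w]; smaller sublinear functions stay odd there,
because p(w) + p(-w) = 0 leaves no room to decrease.  Hence successive
differentiation along [s] makes [p] odd at every vector of [s]. *)
Lemma sublinear_minorant (s : seq 'rV[R]_k) p : is_sublinear p ->
  exists q, [/\ is_sublinear q, (forall u, q u <= p u) &
    {in s, forall w, q (- w) = - q w}].
Proof.
elim: s p => [|w s IHs] p sp; first by exists p.
have [q [sq qp qs]] := IHs _ (directional_derivative_sublinear w sp).
exists q; split=> //.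
  by move=> u; rewrite (le_trans (qp _))// directional_derivative_le_id.
move=> v; rewrite inE => /predU1P[->|/qs//].
apply/le_anti/andP; split; last by have := sublinear_geN w sq; lra.
have := le_trans (qp (- w)) (directional_derivativeN w sp).
have := le_trans (qp w) (directional_derivative_le_id w sp w); lra.
Qed.

(** A sublinear function that is odd on a basis is linear.  Differentiating
first at [v] keeps the value p(v), as the derivative at [v] along [- v] is at
most - p(v). *)
Lemma sublinear_support p (v : 'rV[R]_k) : is_sublinear p ->
  exists2 c : 'I_k -> R, \sum_j c j * v 0 j = p v &
    forall u : 'rV_k, \sum_j c j * u 0 j <= p u.
Proof.
move=> sp.
pose e := [seq delta_mx 0 j | j : 'I_k] : seq 'rV[R]_k.
have [q [sq qp qe]] := sublinear_minorant e (directional_derivative_sublinear v sp).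
(* Sublinearity gives one bound; oddness of [q] on the basis handles
   negative coordinates. *)
have qE0 u : q u <= \sum_j q (delta_mx 0 j) * u 0 j.
  rewrite {1}(row_sum_delta u).
  elim/big_ind2 : _ => [|x a y b xa yb|j _]; first by rewrite sublinear0.
    by rewrite (le_trans (sublinearD sq _ _))// lerD.
  have [u0|/ltW u0] := leP 0 (u 0 j).
    by rewrite (sublinearZ sq) 1?mulrC.
  rewrite -[_ *: _]opprK -scaleNr -scalerN (sublinearZ sq) ?oppr_ge0// qe.
    by rewrite mulrNN mulrC.
  by apply/mapP; exists j; rewrite ?mem_enum.
have qE u : q u = \sum_j q (delta_mx 0 j) * u 0 j.
  apply/le_anti/andP; split; first exact: qE0.
  have := sublinear_geN u sq; apply: le_trans.
  rewrite lerNr (le_trans (qE0 _))// -sumrN.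
  by apply: ler_sum => j _; rewrite mxE mulrN.
have qp' u : q u <= p u by rewrite (le_trans (qp u))// directional_derivative_le_id.
exists (fun j => q (delta_mx 0 j)); last by move=> u; rewrite -qE.
rewrite -qE; apply/le_anti/andP; split; first exact: qp'.
have := le_trans (qp (- v)) (directional_derivativeN v sp).
by have := sublinear_geN v sq; lra.
Qed.

End sublinear.

(** * Norms on row vectors *)

Section norms.
Context (R : realType) (k : nat).
Local Open Scope ring_scope.
Variables (N : 'rV[R]_k -> R).
Hypothesis normN : is_norm N.

Lemma norm_sublinear : is_sublinear N.
Proof.
by split=> [|a u a0]; [exact: is_normD|rewrite (is_normZ normN) ger0_norm].
Qed.

Lemma is_norm0 : N 0 = 0. Proof. exact/sublinear0/norm_sublinear. Qed.

Lemma is_normN u : N (- u) = N u.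
Proof. by rewrite -scaleN1r (is_normZ normN) normrN1 mul1r. Qed.

Lemma is_norm_ge0 u : 0 <= N u.
Proof. by have := sublinear_geN u norm_sublinear; rewrite is_normN; lra. Qed.

Lemma is_norm_le_sum u : N u <= \sum_j `|u 0 j| * N (delta_mx 0 j).
Proof.
rewrite {1}(row_sum_delta u).
elim/big_ind2 : _ => [|x a y b xa yb|j _]; first by rewrite is_norm0.
  by rewrite (le_trans (is_normD normN _ _))// lerD.
by rewrite (is_normZ normN).
Qed.

Lemma norm_support (v : 'rV[R]_k) : exists2 c : 'I_k -> R,
  \sum_j c j * v 0 j = N v &
  forall u : 'rV_k, `|\sum_j c j * u 0 j| <= N u.
Proof.
have [c cv cN] := sublinear_support v norm_sublinear.
exists c => // u; rewrite ler_norml cN andbT lerNl -sumrN -is_normN.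
rewrite (le_trans _ (cN _))//; apply: ler_sum => j _.
by rewrite mxE mulrN.
Qed.

Lemma coord_le_mx_norm (u : 'rV[R]_k) j : `|u 0 j| <= `|u|.
Proof.
rewrite [leRHS]/Num.Def.normr/= mx_normrE.
by apply: (@le_bigmax _ _ _ _ (fun ij : 'I_1 * 'I_k => `|u ij.1 ij.2|) (0, j)).
Qed.

Lemma is_norm_continuous : continuous N.
Proof.
pose K := \sum_j N (delta_mx 0 j).
have K0 : 0 <= K by apply: sumr_ge0 => j _; exact: is_norm_ge0.
have NK u : N u <= K * `|u|.
  rewrite (le_trans (is_norm_le_sum u))// mulr_suml.
  apply: ler_sum => j _; rewrite mulrC ler_wpM2l ?is_norm_ge0//.
  exact: coord_le_mx_norm.
have NB u v : `|N u - N v| <= N (u - v).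
  have := is_normD normN (u - v) v; have := is_normD normN (v - u) u.
  by rewrite !subrK -(is_normN (v - u)) opprB ler_norml; lra.
move=> u; apply/(@cvgrPdist_lt _ _ _ _ (nbhs_filter u)) => e e0.
have K1 : 0 < K + 1 by lra.
have : \forall v \near u, `|u - v| < (K + 1)^-1 * e.
  apply: (@cvgr_dist_lt _ _ _ _ (nbhs_filter u) id).
    exact: cvg_id.
  by rewrite mulr_gt0 ?invr_gt0.
apply: filterS => v uv.
apply: le_lt_trans (NB _ _) _; apply: le_lt_trans (NK _) _.
rewrite (@le_lt_trans _ _ ((K + 1) * `|u - v|))//.
  by rewrite ler_wpM2r//; lra.
by rewrite -ltr_pdivlMl.
Qed.

(** All norms on R^k are equivalent: [N] is continuous and positive on the
compact unit sphere of the sup norm, hence bounded below there. *)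
Lemma coord_le_norm : exists2 C : R, 0 <= C &
  forall (u : 'rV[R]_k) j, `|u 0 j| <= C * N u.
Proof.
pose S := [set u : 'rV[R]_k | `|u| = 1].
have [[u0 Su0]|S0] := pselect (S !=set0); last first.
  exists 0 => // u j; rewrite mul0r (le_trans (coord_le_mx_norm u j))//.
  have [->|u0] := eqVneq u 0; first by rewrite normr0.
  exfalso; apply: S0; exists (`|u|^-1 *: u); rewrite /S/= normrZ.
  by rewrite normrV ?unitfE ?normr_eq0// normr_id mulVf// normr_eq0.
have cS : compact S.
  apply: bounded_closed_compact.
    by exists 1; split => // x x1 u /= ->; exact: ltW.
  apply: (@preimage_closed 'rV[R]_k R Num.norm [set 1]) => [v _|].
    exact: norm_continuous.
  exact/accessible_closed_set1/hausdorff_accessible/Rhausdorff.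
have [c cSc cmin] := EVT_min_rV (ex_intro _ _ Su0) cS
  (continuous_subspaceT is_norm_continuous).
have Nc : 0 < N c.
  rewrite lt_neqAle is_norm_ge0 andbT eq_sym; apply/eqP => /(is_norm0_eq0 normN) c0.
  move: cSc; rewrite inE /S/= c0 normr0 => /eqP; rewrite eq_sym oner_eq0//.
exists (N c)^-1; first by rewrite invr_ge0 ltW.
move=> u j; rewrite (le_trans (coord_le_mx_norm u j))//.
have [->|u1] := eqVneq u 0.
  by rewrite normr0 mulr_ge0 ?invr_ge0 ?is_norm_ge0.
have {}u1 : 0 < `|u| by rewrite normr_gt0.
rewrite ler_pdivlMl// -ler_pdivlMr//.
have -> : N u / `|u| = N (`|u|^-1 *: u).
  by rewrite (is_normZ normN) normrV ?unitfE ?gt_eqF// normr_id mulrC.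
apply: cmin; rewrite inE /S/= normrZ normrV ?unitfE ?gt_eqF// normr_id.
by rewrite mulVf// gt_eqF.
Qed.

(** The norm of a map with measurable coordinates is an infimum of countably
many measurable functions: N v is the infimum of N q + sum_j |v_j - q_j| N(e_j)
over rational vectors [q].  This deals with functions on a product space, such
as T(x) - psi(theta), whose coordinates are visibly measurable. *)
Lemma measurable_is_norm d (T : measurableType d) (f : T -> 'rV[R]_k) :
  (forall j, measurable_fun [set: T] (fun x => f x 0 j)) ->
  measurable_fun [set: T] (N \o f).
Proof.
move=> mf.
pose q_ := fun q : 'rV[rat]_k => map_mx ratr q : 'rV[R]_k.
pose G (q : 'rV[rat]_k) (x : T) :=
  N (q_ q) + \sum_j `|f x 0 j - q_ q 0 j| * N (delta_mx 0 j).
have NG q x : N (f x) <= G q x.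
  rewrite -{1}(subrK (q_ q) (f x)) (le_trans (is_normD normN _ _))//.
  rewrite addrC lerD2l (le_trans (is_norm_le_sum _))//.
  by apply: ler_sum => j _; rewrite !mxE.
have mG q : measurable_fun [set: T] (G q).
  apply: measurable_funD => //; apply: measurable_sum => j.
  apply: measurable_funM => //; apply: measurableT_comp => //.
  by apply: measurable_funB.
have NGlt x c : N (f x) < c -> exists q, G q x < c.
  move=> Nc; pose K := \sum_j N (delta_mx 0 j).
  have K0 : 0 <= K by apply: sumr_ge0 => j _; exact: is_norm_ge0.
  (* Moving each coordinate by less than [e] costs at most [e * K] in each of
     the two terms of [G]. *)
  pose e := (c - N (f x)) / (2 * (K + 1)).
  have e0 : 0 < e by rewrite divr_gt0//; lra.
  have /choice[q qe] : forall j, exists q : rat, `|f x 0 j - ratr q| < e.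
    move=> j; have [q] := @rat_in_itvoo _ (f x 0 j - e) (f x 0 j + e) ltac:(lra).
    rewrite in_itv/= => /andP[q1 q2]; exists q.
    by rewrite ltr_norml; lra.
  exists (\row_j q j); rewrite /G.
  have S1 : \sum_j `|f x 0 j - q_ (\row_j q j) 0 j| * N (delta_mx 0 j) <= e * K.
    rewrite mulr_sumr; apply: ler_sum => j _.
    by rewrite ler_wpM2r ?is_norm_ge0// !mxE ltW.
  have S2 : N (q_ (\row_j q j)) <= N (f x) + e * K.
    rewrite -{1}(subrK (f x) (q_ _)) (le_trans (is_normD normN _ _))//.
    rewrite addrC lerD2l -is_normN opprB (le_trans (is_norm_le_sum _))//.
    by apply: le_trans S1; apply: ler_sum => j _; rewrite !mxE.
  have : 2 * (e * (K + 1)) = c - N (f x).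
    by rewrite /e; field; lra.
  lra.
apply: (measurability _ (RGenInftyO.measurableE R)) => //.
move=> _ [_ [c ->] <-]; rewrite setTI.
rewrite (_ : _ @^-1` _ = \bigcup_q (G q @^-1` `]-oo, c[)).
  apply: countable_bigcupT_measurable => // q.
  by rewrite -[X in measurable X]setTI; exact: mG.
apply/seteqP; split=> x /=.
  by rewrite in_itv/= => /NGlt[q qc]; exists q => //=; rewrite in_itv.
move=> [q _] /=; rewrite !in_itv/=; exact: le_lt_trans.
Qed.

End norms.

(** * The joint law of the observation and the parameter *)

Lemma measurable_rV_coord d (T : measurableType d) (R : realType) (k : nat)
    (f : T -> 'rV[R]_k) j :
  measurable_fun [set: T] f -> measurable_fun [set: T] (fun x => f x 0%R j).
Proof.
move=> mf; apply: (measurability _ (RGenOpens.measurableE R)) => //.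
move=> _ [_ [a [b ->]] <-]; rewrite setTI.
rewrite [X in measurable X](_ : _ = f @^-1` [set v | `]a, b[%classic (v 0%R j)]) //.
rewrite -[X in measurable X]setTI; apply: mf => //.
apply: sub_sigma_algebra.
have /continuousP : continuous (fun v : 'rV[R]_k => v 0%R j).
  by move=> v; exact: coord_continuous.
by apply; exact: interval_open.
Qed.

Section joint_law_integral.
Context (dX dT : measure_display) (X : measurableType dX)
  (Theta : measurableType dT) (R : realType).
Variables (P : dominated_model X Theta R) (Q : probability Theta R).

Import HBNNSimple.

(** The Bayes risk is at most the maximal risk.  It is enough to bound the
integrals of simple functions below [F]: such an integral is a finite sum of
integrals over [theta] of the probabilities of sections, and for each [theta]
their weighted sum is at most the conditional integral of [F]. *)
Lemma joint_law_integral_le (F : X * Theta -> \bar R) (M : \bar R) :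
  measurable_fun [set: X * Theta] F -> (forall z, 0 <= F z) ->
  (forall theta, \int[P theta]_x F (x, theta) <= M) ->
  \int[joint_law P Q]_z F z <= M.
Proof.
move=> mF F0 FM.
rewrite ge0_integralTE//; apply: ge_ereal_sup => _ [h /= hF <-].
pose S (r : R) := h @^-1` [set r].
have mS r : measurable (S r) by exact: measurable_sfunP.
have mPS r : measurable_fun [set: Theta]
    (fun theta => P theta (ysection (S r) theta)).
  exact: measurable_law_ysection.
have M0 : 0 <= M by apply: le_trans (FM point); exact: integral_ge0.
have rPS0 r theta : 0 <= r%:E * P theta (ysection (S r) theta).
  have [r0|r0] := leP 0%R r; first by rewrite mule_ge0// lee_fin.
  by rewrite /S preimage_nnfun0// ysection0 measure0 mule0.
rewrite sintegralE.
have -> : \sum_(r \in range h) r%:E * joint_law P Q (S r) =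
    \int[Q]_theta \sum_(r \in range h) (r%:E * P theta (ysection (S r) theta)).
  rewrite ge0_integral_fsum//; last first.
    by move=> r; exact: measurable_funeM.
  apply: eq_fsbigr => r rh.
  have r0 : (0 <= r)%R by move: rh; rewrite inE => -[z _ <-].
  by rewrite ge0_integralZl// lee_fin.
rewrite [leRHS](_ : M = \int[Q]_theta cst M theta); last first.
  by rewrite integral_cst// [X in _ * X](_ : _ = 1) ?mule1//; exact: probability_setT.
apply: ge0_le_integral => //.
- by move=> theta _; apply: fsume_ge0 => r _.
- apply: emeasurable_fsum => // r.
  by exact: measurable_funeM.
move=> theta _; apply: le_trans (FM theta).
have mpair : measurable_fun [set: X] (fun x => (x, theta)).
  exact: measurable_pair2.
have mind r : measurable_fun [set: X] (fun x => \1_(S r) (x, theta) : R).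
  rewrite (_ : (fun _ => _) = \1_(ysection (S r) theta)).
    by apply: measurable_indic; exact: measurable_ysection.
  by apply/funext => x; rewrite !indicE mem_ysection.
rewrite [leLHS](_ : _ = \int[P theta]_x (h (x, theta))%:E).
  apply: ge0_le_integral => //.
  - by move=> x _; rewrite lee_fin.
  - by apply/measurable_EFinP; apply: measurableT_comp.
  - exact: measurableT_comp.
under [RHS]eq_integral => x _ do rewrite fimfunE -fsumEFin//.
rewrite ge0_integral_fsum//; last 2 first.
- move=> r; apply/measurable_EFinP; apply: measurable_funM => //.
  exact: mind.
- by move=> r x _; rewrite nnfun_muleindic_ge0.
apply: eq_fsbigr => r rh.
have r0 : (0 <= r)%R by move: rh; rewrite inE => -[z _ <-].
under [RHS]eq_integral => x _ do rewrite EFinM.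
rewrite ge0_integralZl//; last exact/measurable_EFinP/mind.
congr (_ * _).
rewrite -[ysection _ _]setIT -integral_indic//; last exact: measurable_ysection.
by apply: eq_integral => x _; rewrite /= !indicE mem_ysection.
Qed.

Lemma joint_law_snd A : measurable A ->
  joint_law P Q (snd @^-1` A) = Q A.
Proof.
move=> mA; rewrite /joint_law.
under eq_integral => theta _.
  rewrite (_ : P theta _ = (\1_A theta)%:E).
    over.
  rewrite indicE; case: (boolP (theta \in A)) => tA.
    rewrite [ysection _ _](_ : _ = setT) ?probability_setT//.
    by apply/seteqP; split=> // x _; rewrite /ysection /= inE/=; exact: set_mem.
  rewrite [ysection _ _](_ : _ = set0) ?measure0//.
  apply/seteqP; split=> // x; rewrite /ysection /= inE/= => At.
  by move/negP: tA; apply; exact: mem_set.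
by rewrite integral_indic// setIT.
Qed.

Lemma ge0_integral_joint_law_snd (f : Theta -> \bar R) :
  measurable_fun [set: Theta] f -> (forall t, 0 <= f t) ->
  \int[joint_law P Q]_z f z.2 = \int[Q]_t f t.
Proof.
move=> mf f0.
rewrite -(@ge0_integral_pushforward _ _ _ _ _ _ measurable_snd (joint_law P Q) setT f)//.
by apply: eq_measure_integral => A mA _; exact: joint_law_snd.
Qed.

Lemma integral_joint_law_snd (f : Theta -> \bar R) :
  Q.-integrable [set: Theta] f ->
  \int[joint_law P Q]_z f z.2 = \int[Q]_t f t.
Proof.
move=> /integrableP[mf intf].
rewrite -(@integral_pushforward _ _ _ _ _ _ measurable_snd (joint_law P Q) setT f)//.
  by apply: eq_measure_integral => A mA _; exact: joint_law_snd.
apply/integrableP; split; first by apply: measurableT_comp => //; exact: measurable_snd.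
rewrite (ge0_integral_joint_law_snd (f := fun t => `|f t|))//.
exact: measurableT_comp.
Qed.

End joint_law_integral.

(** * Differences of means and the Hellinger distance *)

Section hellinger_inequality.
Context (dT : measure_display) (T : measurableType dT) (R : realType).

(** The Radon-Nikodym derivative is that of a charge: it is extended-real-valued
and, for a measure, nonnegative only almost everywhere.  This provides a version
that is real and nonnegative everywhere, with its two change of variables
formulas. *)
Lemma real_density (nu : {finite_measure set T -> \bar R})
    (mu : {sigma_finite_measure set T -> \bar R}) : nu `<< mu ->
  exists f : T -> R, [/\ (forall x, 0 <= f x)%R, measurable_fun [set: T] f,
    ae_eq mu [set: T] ('d (charge_of_finite_measure nu) '/d mu) (EFin \o f),
    (forall u : T -> \bar R, measurable_fun [set: T] u -> (forall x, 0 <= u x) ->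
      \int[mu]_x (u x * (f x)%:E) = \int[nu]_x u x) &
    (forall u : T -> \bar R, nu.-integrable [set: T] u ->
      mu.-integrable [set: T] (fun x => u x * (f x)%:E) /\
      \int[mu]_x (u x * (f x)%:E) = \int[nu]_x u x)].
Proof.
move=> numu; pose F := Radon_Nikodym_SigmaFinite.f nu mu.
have F0 : forall x, 0 <= F x := Radon_Nikodym_SigmaFinite.f_ge0 numu.
have Ffin : forall x, F x \is a fin_num := Radon_Nikodym_SigmaFinite.f_fin_num numu.
have mF : measurable_fun [set: T] F.
  exact: measurable_int (Radon_Nikodym_SigmaFinite.f_integrable numu).
have FE x : (fine (F x))%:E = F x by rewrite fineK.
have FEf : (fun x => (fine (F x))%:E) = F by apply/funext.
have cov (u : T -> \bar R) : measurable_fun [set: T] u -> (forall x, 0 <= u x) ->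
    \int[mu]_x (u x * (fine (F x))%:E) = \int[nu]_x u x.
  move=> mu0 u0; under eq_integral do rewrite FE.
  exact: Radon_Nikodym_SigmaFinite.change_of_variables.
exists (fine \o F); split=> //.
- by move=> x; rewrite fine_ge0.
- by apply/measurable_EFinP; rewrite (_ : _ \o _ = F).
- rewrite (_ : EFin \o _ = F)//; apply/ae_eq_sym.
  exact: ae_eq_Radon_Nikodym_SigmaFinite.
move=> u iu; have /integrableP[mu0 uoo] := iu; split.
  apply/integrableP; split.
    by apply: emeasurable_funM => //=; rewrite FEf.
  under eq_integral => x _ do rewrite abseM [X in _ * X]gee0_abs ?lee_fin ?fine_ge0//.
  by rewrite (cov (fun x => `|u x|))//; exact: measurableT_comp.
rewrite -(Radon_Nikodym_change_of_variables numu measurableT iu).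
apply: ae_eq_integral => //.
- by apply: emeasurable_funM => //=; rewrite FEf.
- by apply: emeasurable_funM.
rewrite /= (_ : (fun x => _) = u \* F); last by apply/funext => x /=; rewrite FE.
by apply: ae_eqe_mul2l; exact: ae_eq_Radon_Nikodym_SigmaFinite.
Qed.

(** Factor a - b = (sqrt a - sqrt b) (sqrt a + sqrt b), apply Young's inequality
to the two factors and bound (sqrt a + sqrt b)^2 by 2 (a + b). *)
Lemma young_sqrt (eta g a b : R) : (0 < eta -> 0 <= a -> 0 <= b ->
  `|g * (a - b)| <= eta * (Num.sqrt a - Num.sqrt b) ^+ 2 +
     (2 * eta)^-1 * (g ^+ 2 * (a + b)))%R.
Proof.
move=> eta0 a0 b0.
rewrite -{1 3}(sqr_sqrtr a0) -{1 3}(sqr_sqrtr b0).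
move: (Num.sqrt a) (Num.sqrt b) => x y.
rewrite -(ler_pM2l (_ : 0 < 2 * eta)%R); last lra.
rewrite [leRHS]mulrDr mulVKf; last by rewrite gt_eqF//; lra.
rewrite -{1}(gtr0_norm (_ : 0 < 2 * eta)%R); last lra.
rewrite -normrM ler_norml; apply/andP; split.
  have := sqr_ge0 (2 * eta * (x - y) + g * (x + y))%R.
  have := sqr_ge0 (g * (x - y))%R.
  lra.
have := sqr_ge0 (2 * eta * (x - y) - g * (x + y))%R.
have := sqr_ge0 (g * (x - y))%R.
lra.
Qed.

Lemma integrable_of_sqr (mu : probability T R) (g : T -> R) :
  measurable_fun [set: T] g -> \int[mu]_x ((g x) ^+ 2)%:E < +oo ->
  mu.-integrable [set: T] (EFin \o g).
Proof.
move=> mg goo.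
(* |g| <= 1 + g^2, and constants are integrable for a probability. *)
apply: (@le_integrable _ _ _ _ _ measurableT _ (fun x => (1 + g x ^+ 2)%:E)).
- exact/measurable_EFinP.
- move=> x _; rewrite /= lee_fin [leRHS]ger0_norm ?addr_ge0 ?sqr_ge0//.
  rewrite ler_norml; have := sqr_ge0 (g x - 1)%R; have := sqr_ge0 (g x + 1)%R.
  by rewrite !expr2; lra.
under eq_fun do rewrite EFinD.
apply: integrableD => //; first exact: finite_measure_integrable_cst.
apply/integrableP; split; first by apply/measurable_EFinP; exact: measurable_funX.
by under eq_integral => x _ do rewrite gee0_abs ?lee_fin ?sqr_ge0//.
Qed.

Variables P0 P1 : probability T R.

(** The integral of [young_sqrt] with [a] and [b] the two densities.  Keeping
[eta] free instead of taking a product of square roots covers a vanishing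
Hellinger distance as well. *)
Lemma hellinger_mean_difference (g : T -> R) (eta : R) : (0 < eta)%R ->
  measurable_fun [set: T] g ->
  \int[P0]_x ((g x) ^+ 2)%:E < +oo -> \int[P1]_x ((g x) ^+ 2)%:E < +oo ->
  `|\int[P0]_x (g x)%:E - \int[P1]_x (g x)%:E| <=
    eta%:E * hellinger2 P0 P1 +
    ((2 * eta)^-1)%:E * (\int[P0]_x ((g x) ^+ 2)%:E + \int[P1]_x ((g x) ^+ 2)%:E).
Proof.
move=> eta0 mg g0oo g1oo; pose mu := measure_add P0 P1.
have muE A : mu A = P0 A + P1 A by exact: measure_addE.
have dom0 : P0 `<< mu.
  apply/null_content_dominatesP => A mA mu0; have /eqP := etrans (esym (muE A)) mu0.
  by rewrite padde_eq0 ?measure_ge0// => /andP[/eqP].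
have dom1 : P1 `<< mu.
  apply/null_content_dominatesP => A mA mu0; have /eqP := etrans (esym (muE A)) mu0.
  by rewrite padde_eq0 ?measure_ge0// => /andP[_ /eqP].
have [f0 [f0_ge0 mf0 ae0 cov0 icov0]] := real_density dom0.
have [f1 [f1_ge0 mf1 ae1 cov1 icov1]] := real_density dom1.
have mg2 : measurable_fun [set: T] (fun x => (g x ^+ 2)%:E).
  by apply/measurable_EFinP; exact: measurable_funX.
have g2_ge0 x : 0 <= (g x ^+ 2)%:E by rewrite lee_fin sqr_ge0.
have [ig0 <-] := icov0 _ (integrable_of_sqr mg g0oo).
have [ig1 <-] := icov1 _ (integrable_of_sqr mg g1oo).
rewrite -(cov0 _ mg2 g2_ge0) -(cov1 _ mg2 g2_ge0).
have msqrt (f : T -> R) : measurable_fun [set: T] f ->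
    measurable_fun [set: T] (fun x => Num.sqrt (f x)).
  move=> mf; exact: measurableT_comp (continuous_measurable_fun (@sqrt_continuous R)) mf.
have mHell (a b : T -> R) : measurable_fun [set: T] a ->
    measurable_fun [set: T] b -> measurable_fun [set: T]
      (fun x => ((Num.sqrt (a x) - Num.sqrt (b x)) ^+ 2)%:E).
  move=> ma mb; apply/measurable_EFinP/measurable_funX.
  by apply: measurable_funB; exact: msqrt.
have mH := mHell _ _ mf0 mf1.
have mRN (nu : {finite_measure set T -> \bar R}) : nu `<< mu ->
    measurable_fun [set: T] (fine \o 'd (charge_of_finite_measure nu) '/d mu).
  move=> numu; apply/measurable_EFinP.
  rewrite (_ : EFin \o _ = 'd (charge_of_finite_measure nu) '/d mu)//.
  by apply/funext => x; rewrite /= fineK// Radon_Nikodym_fin_num.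
(* The Hellinger integrand may be computed with the versions [f0] and [f1]. *)
have -> : hellinger2 P0 P1 =
    \int[mu]_x ((Num.sqrt (f0 x) - Num.sqrt (f1 x)) ^+ 2)%:E.
  rewrite /hellinger2 -/mu.
  under eq_integral => x _.
    rewrite -[X in sqrte X - _](@fineK R) ?Radon_Nikodym_fin_num//.
    rewrite -[X in _ - sqrte X](@fineK R) ?Radon_Nikodym_fin_num//.
    rewrite /sqrte -EFinB -EFin_expe.
    over.
  apply: ae_eq_integral => //; first by apply: mHell; exact: mRN.
  by apply: filterS2 ae0 ae1 => x /(_ I) -> /(_ I) -> _ /=.
have mgf (f : T -> R) : measurable_fun [set: T] f ->
    measurable_fun [set: T] (fun x => (g x ^+ 2)%:E * (f x)%:E).
  by move=> mf; apply: emeasurable_funM => //; exact/measurable_EFinP.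
have gf_ge0 (f : T -> R) : (forall x, 0 <= f x)%R ->
    forall x, 0 <= (g x ^+ 2)%:E * (f x)%:E.
  by move=> f_ge0 x; rewrite mule_ge0// lee_fin.
rewrite -integralB//.
apply: le_trans (le_abse_integral _ _ _) _ => //.
  exact: measurable_int (integrableB measurableT ig0 ig1).
rewrite -(ge0_integralD _ measurableT); last 4 first.
- by move=> x _; exact: gf_ge0.
- exact: mgf.
- by move=> x _; exact: gf_ge0.
- exact: mgf.
rewrite -(ge0_integralZl _ measurableT); last 3 first.
- by apply: emeasurable_funD; exact: mgf.
- by move=> x _; rewrite adde_ge0// gf_ge0.
- by rewrite lee_fin invr_ge0 mulr_ge0// ltW.
rewrite -(ge0_integralZl _ measurableT); last 3 first.
- exact: mH.
- by move=> x _; rewrite lee_fin sqr_ge0.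
- by rewrite lee_fin ltW.
rewrite -(ge0_integralD _ measurableT); last 4 first.
- by move=> x _; rewrite mule_ge0// lee_fin ?sqr_ge0// ltW.
- exact: measurable_funeM.
- move=> x _; rewrite mule_ge0 ?adde_ge0 ?gf_ge0// lee_fin invr_ge0 mulr_ge0// ltW//.
- by apply: measurable_funeM; apply: emeasurable_funD; exact: mgf.
apply: ge0_le_integral => //.
- apply: measurableT_comp => //.
  exact: measurable_int (integrableB measurableT ig0 ig1).
- apply: emeasurable_funD; first exact: measurable_funeM.
  by apply: measurable_funeM; apply: emeasurable_funD; exact: mgf.
move=> x _.
rewrite -!EFinM -EFinB -!EFinD.
rewrite -mulrBr -mulrDr.
rewrite abse_EFin lee_fin.
exact: young_sqrt.
Qed.

End hellinger_inequality.

(** * The two-point bound *)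

(** Convexity of the square, with weights a / (a + b) and b / (a + b) on x / a
and y / b.  If E x^2 <= a^2 and E y^2 <= b^2, integration gives
E (x + y)^2 <= (a + b)^2, which is Minkowski's inequality. *)
Lemma sqr_add_le (R : realFieldType) (a b x y : R) : (0 < a -> 0 < b ->
  (x + y) ^+ 2 <= (a + b) / a * x ^+ 2 + (a + b) / b * y ^+ 2)%R.
Proof.
move=> a0 b0; rewrite -(ler_pM2l (mulr_gt0 a0 b0)).
have -> : (a * b * ((a + b) / a * x ^+ 2 + (a + b) / b * y ^+ 2) =
    (a + b) * (b * x ^+ 2 + a * y ^+ 2))%R by field; rewrite !gt_eqF.
by have := sqr_ge0 (b * x - a * y)%R; lra.
Qed.

Section two_point_bound.
Context (dX : measure_display) (X : measurableType dX) (R : realType) (d k : nat).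
Variables (P : dominated_model X 'rV[R]_d R) (psi : 'rV[R]_d -> 'rV[R]_k)
  (N : 'rV[R]_k -> R) (Q : probability 'rV[R]_d R) (h : 'rV[R]_d).
Hypotheses (mpsi : measurable_fun [set: 'rV[R]_d] psi) (normN : is_norm N).

Let incr (t : 'rV[R]_d) : 'rV[R]_k := (psi t - psi (t - h))%R.

Let mpsij j : measurable_fun [set: 'rV[R]_d] (fun t => psi t 0%R j).
Proof. exact: measurable_rV_coord. Qed.

Let mpsihj j : measurable_fun [set: 'rV[R]_d] (fun t => psi (t - h)%R 0%R j).
Proof.
apply: (measurable_rV_coord (f := psi \o (fun t => t - h)%R)).
apply: measurableT_comp => //; apply: continuous_measurable_rV => t.
by apply: (@continuousB _ _ _ id (cst h) t); [exact: id|exact: cst_continuous].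
Qed.

Let mincr j : measurable_fun [set: 'rV[R]_d] (fun t => incr t 0%R j).
Proof.
rewrite (_ : (fun _ => _) = (fun t => psi t 0 j - psi (t - h) 0 j)%R); last first.
  by apply/funext => t; rewrite /incr !mxE.
exact: measurable_funB.
Qed.

Let mNincr : measurable_fun [set: 'rV[R]_d] (fun t => N (incr t)).
Proof. exact: (measurable_is_norm normN). Qed.

Lemma integrable_incr j : B_psi psi N Q h < +oo ->
  Q.-integrable [set: 'rV[R]_d] (fun t => (incr t 0%R j)%:E).
Proof.
move=> Boo; apply: integrable_of_sqr => //.
have [C C0 CN] := coord_le_norm normN.
have mN2 : measurable_fun [set: 'rV[R]_d] (fun t => (N (incr t) ^+ 2)%:E).
  exact/measurable_EFinP/measurable_funX.
apply: (@le_lt_trans _ _ (\int[Q]_t ((C ^+ 2)%:E * (N (incr t) ^+ 2)%:E))).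
  apply: ge0_le_integral => //.
  - by move=> t _; rewrite lee_fin sqr_ge0.
  - exact/measurable_EFinP/measurable_funX.
  - exact: measurable_funeM.
  - move=> t _; rewrite -EFinM lee_fin -exprMn -real_normK ?num_real//.
    by rewrite lerXn2r ?nnegrE// mulr_ge0// is_norm_ge0.
rewrite ge0_integralZl//; first by rewrite lte_mul_pinfty// lee_fin sqr_ge0.
- by move=> t _; rewrite lee_fin sqr_ge0.
- by rewrite lee_fin sqr_ge0.
Qed.

Lemma integral_functional_incr (c : 'I_k -> R) : B_psi psi N Q h < +oo ->
  Q.-integrable [set: 'rV[R]_d] (fun t => (\sum_j c j * incr t 0 j)%R%:E) /\
  \int[Q]_t (\sum_j c j * incr t 0 j)%R%:E =
    (\sum_j c j * mean_increment psi Q h 0 j)%R%:E.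
Proof.
move=> Boo.
have icj j : Q.-integrable [set: 'rV[R]_d] (fun t => ((c j)%:E * (incr t 0%R j)%:E)).
  by apply: integrableZl => //; exact: integrable_incr.
have E : (fun t => (\sum_j c j * incr t 0 j)%R%:E) =
    (fun t => \sum_j ((c j)%:E * (incr t 0%R j)%:E)).
  by apply/funext => t; rewrite -sumEFin; apply: eq_bigr => j _; rewrite EFinM.
rewrite E; split; first exact: integrable_sum.
rewrite integral_sum// -sumEFin; apply: eq_bigr => j _.
rewrite integralZl//; last exact: integrable_incr.
rewrite EFinM; congr (_ * _).
rewrite mxE /Rintegral [X in fine X](_ : _ = \int[Q]_t (incr t 0%R j)%:E).
  by rewrite fineK// integrable_fin_num// integrable_incr.
by apply: eq_integral => t _; rewrite /incr !mxE.
Qed.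

(** The main estimate.  Here [g z] is the functional [l] of the error, and
[g (sh z)] is the same quantity when theta is replaced by theta - h; their
difference [l (incr z.2)] depends on theta only, and by the choice of [l] its
mean is the norm of the mean increment. *)
Lemma norm_mean_increment_le (T : X -> 'rV[R]_k) (a b eta : R) :
  measurable_fun [set: X] T -> (0 < a)%R -> (0 < b)%R -> (0 < eta)%R ->
  (forall theta, risk P psi N T theta <= (a ^+ 2)%:E) ->
  B_psi psi N Q h <= (b ^+ 2)%:E ->
  (N (mean_increment psi Q h))%:E <=
    eta%:E * hellinger2 (joint_law P Q) (shifted_joint_law P Q h) +
    (eta^-1 * (a + b) ^+ 2)%:E.
Proof.
move=> mT a0 b0 eta0 riskT Bb.
have Boo : B_psi psi N Q h < +oo by rewrite (le_lt_trans Bb)// ltry.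
have [c cN cle] := norm_support normN (mean_increment psi Q h).
pose l (u : 'rV[R]_k) : R := (\sum_j c j * u 0 j)%R.
have lD u v : l (u + v)%R = (l u + l v)%R.
  rewrite /l -big_split/=; apply: eq_bigr => j _; rewrite mxE mulrDr//.
have sqrl u : (l u ^+ 2 <= N u ^+ 2)%R.
  rewrite -real_normK ?num_real//.
  by rewrite lerXn2r ?nnegrE ?is_norm_ge0//; exact: cle.
have ml dY (Y : measurableType dY) (f : Y -> 'rV[R]_k) :
    (forall j, measurable_fun [set: Y] (fun y => f y 0%R j)) ->
    measurable_fun [set: Y] (fun y => l (f y)).
  by move=> mf; apply: measurable_sum => j; apply: measurable_funM.
pose err (z : X * 'rV[R]_d) : 'rV[R]_k := (T z.1 - psi z.2)%R.
have merr j : measurable_fun [set: X * 'rV[R]_d] (fun z => err z 0%R j).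
  rewrite (_ : (fun _ => _) = (fun z => T z.1 0 j - psi z.2 0 j)%R); last first.
    by apply/funext => z; rewrite /err !mxE.
  apply: measurable_funB.
    apply: (measurableT_comp (f := fun x => T x 0%R j)); last exact: measurable_fst.
    exact: measurable_rV_coord.
  by apply: (measurableT_comp (f := fun x => psi x 0%R j)); last exact: measurable_snd.
pose g z := l (err z).
pose sh := shift_parameter h : X * 'rV[R]_d -> X * 'rV[R]_d.
have msh : measurable_fun [set: X * 'rV[R]_d] sh := measurable_shift_parameter h.
have mg : measurable_fun [set: X * 'rV[R]_d] g by exact: ml.
have mgsh : measurable_fun [set: X * 'rV[R]_d] (g \o sh) by exact: measurableT_comp.
have gsh z : g (sh z) = (g z + l (incr z.2))%R.
  rewrite /g /err /incr /sh /shift_parameter/= -lD; congr l.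
  by rewrite addrA subrK.
have mNerr : measurable_fun [set: X * 'rV[R]_d] (fun z => N (err z)).
  exact: (measurable_is_norm normN).
pose u2 z := (N (err z) ^+ 2)%:E.
pose v2 (z : X * 'rV[R]_d) := (N (incr z.2) ^+ 2)%:E.
have mu2 : measurable_fun [set: X * 'rV[R]_d] u2.
  exact/measurable_EFinP/measurable_funX.
have mv2 : measurable_fun [set: X * 'rV[R]_d] v2.
  apply/measurable_EFinP/measurable_funX.
  by apply: (measurableT_comp (f := fun t => N (incr t))); last exact: measurable_snd.
have Eu : \int[joint_law P Q]_z u2 z <= (a ^+ 2)%:E.
  by apply: joint_law_integral_le => // z; rewrite lee_fin sqr_ge0.
have Ev : \int[joint_law P Q]_z v2 z <= (b ^+ 2)%:E.
  rewrite (ge0_integral_joint_law_snd P Q (f := fun t => (N (incr t) ^+ 2)%:E))//.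
    exact/measurable_EFinP/measurable_funX.
  by move=> t; rewrite lee_fin sqr_ge0.
have Eg0 : \int[joint_law P Q]_z (g z ^+ 2)%:E <= (a ^+ 2)%:E.
  apply: le_trans Eu; apply: ge0_le_integral => //.
  - by move=> z _; rewrite lee_fin sqr_ge0.
  - exact/measurable_EFinP/measurable_funX.
  - by move=> z _; rewrite lee_fin sqrl.
have Egsh : \int[joint_law P Q]_z (g (sh z) ^+ 2)%:E <= ((a + b) ^+ 2)%:E.
  apply: (@le_trans _ _ (\int[joint_law P Q]_z
     (((a + b) / a)%:E * u2 z + ((a + b) / b)%:E * v2 z))).
    apply: ge0_le_integral => //.
    - by move=> z _; rewrite lee_fin sqr_ge0.
    - exact/measurable_EFinP/measurable_funX.
    - by apply: emeasurable_funD; exact: measurable_funeM.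
    move=> z _; rewrite /u2 /v2 -!EFinM -EFinD lee_fin gsh.
    apply: le_trans (sqr_add_le _ _ a0 b0) _.
    by apply: lerD; apply: ler_wpM2l (sqrl _); rewrite divr_ge0 ?addr_ge0// ltW.
  have ab_ge0 (e : R) : (0 < e)%R -> 0 <= ((a + b) / e)%:E.
    by move=> e0; rewrite lee_fin divr_ge0 ?addr_ge0// ltW.
  have sq0 z : 0 <= u2 z by rewrite lee_fin sqr_ge0.
  have sq1 z : 0 <= v2 z by rewrite lee_fin sqr_ge0.
  rewrite (ge0_integralD _ measurableT); last 4 first.
  - by move=> z _; rewrite mule_ge0// ab_ge0.
  - exact: measurable_funeM.
  - by move=> z _; rewrite mule_ge0// ab_ge0.
  - exact: measurable_funeM.
  rewrite !(ge0_integralZl _ measurableT)//; [|exact: ab_ge0|exact: ab_ge0].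
  apply: (@le_trans _ _
    (((a + b) / a)%:E * (a ^+ 2)%:E + ((a + b) / b)%:E * (b ^+ 2)%:E)).
    by apply: leeD; apply: lee_wpmul2l => //; exact: ab_ge0.
  rewrite -!EFinM -EFinD lee_fin le_eqVlt; apply/orP; left; apply/eqP.
  by field; rewrite !gt_eqF.
have Eg1 : \int[shifted_joint_law P Q h]_z (g z ^+ 2)%:E <= ((a + b) ^+ 2)%:E.
  rewrite ge0_integral_distribution//; first exact/measurable_EFinP/measurable_funX.
  by move=> z; rewrite lee_fin sqr_ge0.
have ltoo (x : \bar R) (r : R) : x <= r%:E -> x < +oo.
  by move=> xr; rewrite (le_lt_trans xr)// ltry.
have ig := integrable_of_sqr mg (ltoo _ _ Eg0).
have igsh := integrable_of_sqr mgsh (ltoo _ _ Egsh).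
have [iincr Eincr] := integral_functional_incr c Boo.
have Eg : \int[shifted_joint_law P Q h]_z (g z)%:E = \int[joint_law P Q]_z (g (sh z))%:E.
  by rewrite integral_distribution//; exact/measurable_EFinP.
have diff : \int[joint_law P Q]_z (g (sh z))%:E - \int[joint_law P Q]_z (g z)%:E
    = (N (mean_increment psi Q h))%:E.
  rewrite -integralB// -cN -Eincr.
  rewrite -(integral_joint_law_snd P iincr).
  by apply: eq_integral => z _; rewrite /= gsh -EFinB addrAC subrr add0r.
have := hellinger_mean_difference eta0 mg (ltoo _ _ Eg0) (ltoo _ _ Eg1).
rewrite Eg -abseN fin_num_oppeB; last by rewrite (integrable_fin_num _ igsh).
rewrite [X in `|X|]addeC diff gee0_abs ?lee_fin ?is_norm_ge0//.
move=> /le_trans; apply; apply: leeD => //.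
apply: (@le_trans _ _ ((2 * eta)^-1%:E * ((a ^+ 2)%:E + ((a + b) ^+ 2)%:E))).
  by apply: lee_wpmul2l; [rewrite lee_fin invr_ge0 mulr_ge0// ltW|exact: leeD].
rewrite -EFinD -EFinM lee_fin invfM [(_^-1 * _^-1)%R]mulrC -mulrA.
rewrite ler_pM2l ?invr_gt0// ler_pdivrMl//.
have := mulr_ge0 (ltW a0) (ltW b0); have := sqr_ge0 b.
lra.
Qed.

(** Let H be the Hellinger distance.  The optimal choice in
[norm_mean_increment_le] is eta = (a + b) / H.  If H = 0, letting eta tend to
infinity shows that the mean increment vanishes, and then A = 0 / 0 = 0; if H
is infinite then A = 0. *)
Lemma A_psi_le (T : X -> 'rV[R]_k) (a b : R) :
  measurable_fun [set: X] T -> (0 < a)%R -> (0 < b)%R ->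
  (forall theta, risk P psi N T theta <= (a ^+ 2)%:E) ->
  B_psi psi N Q h <= (b ^+ 2)%:E ->
  A_psi P psi N Q h <= ((a + b) ^+ 2)%:E.
Proof.
move=> mT a0 b0 riskT Bb.
have main eta (eta0 : (0 < eta)%R) :=
  norm_mean_increment_le mT a0 b0 eta0 riskT Bb.
rewrite /A_psi; set D := N _ in main *; set H2 := hellinger2 _ _ in main *.
have D0 : (0 <= D)%R by exact: is_norm_ge0.
have s0 : (0 < a + b)%R by rewrite addr_gt0.
have H2_ge0 : 0 <= H2.
  apply: integral_ge0 => z _; exact: sqre_ge0.
case: H2 H2_ge0 main => [r| |] //= r0 main; last first.
  by rewrite mulry gtr0_sg// mul1e invey mule0 lee_fin sqr_ge0.
rewrite -EFinM inver.
move: r0; rewrite lee_fin le_eqVlt => /predU1P[r0|r0].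
  rewrite -r0 mulr0 eqxx.
  suff -> : D = 0%R by rewrite expr0n/= mul0e lee_fin sqr_ge0.
  apply/eqP; rewrite eq_le D0 andbT leNgt; apply/negP => Dgt0.
  (* This [eta] makes the right-hand side equal to D / 2. *)
  have eta0 : (0 < 2 * (a + b) ^+ 2 / D)%R.
    by rewrite divr_gt0// mulr_gt0// exprn_gt0.
  have := main _ eta0; rewrite -r0 mule0 add0e lee_fin.
  rewrite [leRHS](_ : _ = D / 2)%R; first by move=> ?; lra.
  by field; rewrite !gt_eqF.
rewrite gt_eqF ?mulr_gt0// -EFinM lee_fin ler_pdivrMr ?mulr_gt0//.
have sr : (0 < Num.sqrt r)%R by rewrite sqrtr_gt0.
have := main _ (divr_gt0 s0 sr); rewrite -EFinM -EFinD lee_fin => Dle.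
have {}Dle : (D <= 2 * (a + b) * Num.sqrt r)%R.
  apply: le_trans Dle _; rewrite le_eqVlt; apply/orP; left; apply/eqP.
  rewrite -{2}(sqr_sqrtr (ltW r0)); field.
  by rewrite !gt_eqF.
apply: (@le_trans _ _ ((2 * (a + b) * Num.sqrt r) ^+ 2)%R).
  by rewrite lerXn2r ?nnegrE// (le_trans D0).
rewrite exprMn sqr_sqrtr ?(ltW r0)//.
lra.
Qed.

End two_point_bound.

Theorem theorem7 (R : realType) (dX : measure_display) (X : measurableType dX)
    (d k : nat) (P : dominated_model X 'rV[R]_d R)
    (psi : 'rV[R]_d -> 'rV[R]_k) (mpsi : measurable_fun [set: 'rV[R]_d] psi)
    (N : 'rV[R]_k -> R) (normN : is_norm N)
    (Q : probability 'rV[R]_d R) :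
  ereal_sup [set (bracket P psi N Q h) ^+ 2 | h in [set: 'rV[R]_d]]
    <= minimax_risk P psi N.
Proof.
apply: ge_ereal_sup => _ [h _ <-]; apply: le_ereal_inf_tmp => _ [T mT <-].
set M := ereal_sup _.
have riskM theta : risk P psi N T theta <= M.
  by apply: ereal_sup_ubound; exists theta.
have M0 : 0 <= M.
  apply: le_trans (riskM 0%R).
  by apply: integral_ge0 => x _; rewrite lee_fin sqr_ge0.
rewrite /bracket; case: ifPn => [_|BNoo]; first by rewrite expe2 mule0.
have B0 : 0 <= B_psi psi N Q h.
  by apply: integral_ge0 => x _; rewrite lee_fin sqr_ge0.
case EM : M M0 => [m| |] // M0; last by rewrite leey.
case EB : (B_psi psi N Q h) B0 BNoo => [b| |] // B0 _.
rewrite lee_fin in M0; rewrite lee_fin in B0.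
(* The square roots may vanish, so they are enlarged by a positive [e]. *)
have Ale (e : R) : (0 < e)%R ->
    A_psi P psi N Q h <= ((Num.sqrt m + e + (Num.sqrt b + e)) ^+ 2)%:E.
  move=> e0; have sq (x : R) : (0 <= x)%R -> (x <= (Num.sqrt x + e) ^+ 2)%R.
    move=> x0; rewrite -{1}(sqr_sqrtr x0) lerXn2r ?nnegrE ?addr_ge0 ?sqrtr_ge0// ?ltW//.
    by rewrite ltrDl.
  apply: (A_psi_le mpsi normN mT).
  - by rewrite ltr_wpDl// sqrtr_ge0.
  - by rewrite ltr_wpDl// sqrtr_ge0.
  - by move=> theta; rewrite (le_trans (riskM theta))// EM lee_fin sq.
  - by rewrite EB lee_fin sq.
have : sqrte (A_psi P psi N Q h) <= (Num.sqrt m + Num.sqrt b)%:E.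
  apply/lee_addgt0Pr => e e0.
  have := Ale (e / 2)%R; rewrite divr_gt0// => /(_ isT).
  rewrite -lee_sqrt ?lee_fin ?sqr_ge0// => /le_trans; apply.
  rewrite /sqrte sqrtr_sqr ger0_norm -?EFinD ?lee_fin; last first.
    by rewrite !addr_ge0 ?sqrtr_ge0// ltW// divr_gt0.
  lra.
have := sqrte_ge0 (A_psi P psi N Q h).
case: (sqrte _) => [s| |]//; rewrite !lee_fin => s0 sle.
rewrite /sqrte -EFinB -EFin_max -EFin_expe lee_fin -(sqr_sqrtr M0).
rewrite lerXn2r ?nnegrE ?sqrtr_ge0 ?le_max ?lexx ?orbT//.
by rewrite ge_max sqrtr_ge0 andbT; lra.
Qed.
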